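(* Let $m\ge 5$ be an integer with $\gcd(m,3)=1$. Then for every positive integer $x$, $$|S_m(x)|\leq \mu_m\, x^{\lambda_m}.$$
   Context: For a nonnegative integer $n$, $s(n)$ denotes the number of 1's in the binary expansion of $n$ (so $s(0)=0$). For positive integers $x,m$ put $$S_m(x)=\sum_{0\le n<x,\ n\equiv 0\ (\mathrm{mod}\ m)}(-1)^{s(n)}.$$ For $m\geq 5$ let $b_m>0$ be defined by $$b_m^2=\begin{cases}\sin\left(\frac{\pi}{3}\left(1+\frac{3}{m}\right)\right)\left(\sqrt{3}-\sin\left(\frac{\pi}{3}\left(1+\frac{3}{m}\right)\right)\right), & m\equiv 0\pmod 3,\\ \sin\left(\frac{\pi}{3}\left(1-\frac{1}{m}\right)\right)\left(\sqrt{3}-\sin\left(\frac{\pi}{3}\left(1-\frac{1}{m}\right)\right)\right), & m\equiv 1\pmod 3,\\ \sin\left(\frac{\pi}{3}\left(1+\frac{1}{m}\right)\right)\left(\sqrt{3}-\sin\left(\frac{\pi}{3}\left(1+\frac{1}{m}\right)\right)\right), & m\equiv 2\pmod 3,\end{cases}$$ and put $$\lambda_m=1+\log_2 b_m,\qquad \mu_m=\frac{2b_m+1}{2b_m-1}.$$ *)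

(* Defs.v *)
From mathcomp Require Import all_boot all_order all_algebra.
From mathcomp Require Import all_classical all_reals all_analysis.
From mathcomp Require Import lra.

Set Implicit Arguments.
Unset Strict Implicit.
Unset Printing Implicit Defensive.

Import Order.TTheory GRing.Theory Num.Theory.

Local Open Scope ring_scope.

(* The bit of weight 2^i of n is odd (n %/ 2 ^ i); since n < 2 ^ n, all the
   nonzero bits have index i < n. *)
Definition binary_ones (n : nat) : nat := (\sum_(i < n) odd (n %/ 2 ^ i))%N.

Definition S_ (m x : nat) : int :=
  \sum_(0 <= n < x | (m %| n)%N) (-1) ^+ binary_ones n.

Definition sin_arg (R : realType) (m : nat) : R :=
  if (m %% 3 == 0)%N then pi / 3 * (1 + 3 / m%:R)
  else if (m %% 3 == 1)%N then pi / 3 * (1 - 1 / m%:R)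
  else pi / 3 * (1 + 1 / m%:R).

Definition b_sqr (R : realType) (m : nat) : R :=
  sin (sin_arg R m) * (Num.sqrt 3 - sin (sin_arg R m)).

(* Num.sqrt is 0 on negative reals, but b_sqr R m > 0 for 5 <= m: see b_spec. *)
Definition b (R : realType) (m : nat) : R := Num.sqrt (b_sqr R m).

Definition lambda (R : realType) (m : nat) : R := 1 + ln (b R m) / ln 2.

Definition mu (R : realType) (m : nat) : R :=
  (2 * b R m + 1) / (2 * b R m - 1).

Lemma b_spec (R : realType) (m : nat) :
  (5 <= m)%N -> 0 < b R m /\ b R m ^+ 2 = b_sqr R m.
Proof.
move=> m5; suff Hb : 0 < b_sqr R m.
  by split; [rewrite sqrtr_gt0 | rewrite sqr_sqrtr // ltW].
have pi0 := pi_gt0 R.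
have m5' : 5 <= m%:R :> R by rewrite ler_nat.
have m0 : 0 < m%:R :> R by lra.
have i0 : 0 < (m%:R : R)^-1 by rewrite invr_gt0.
have i5 : (m%:R : R)^-1 <= 5^-1 by rewrite lef_pV2 ?posrE //.
have Hs : 0 < sin (sin_arg R m).
  apply: sin_gt0_pi; rewrite /sin_arg.
  by case: ifP => _; [|case: ifP => _]; apply/andP; split; nra.
have s3 : 1 < Num.sqrt 3 :> R by rewrite -[ltLHS]sqrtr1 ltr_sqrt; lra.
have := sin_le1 (sin_arg R m).
by move=> s1; apply: mulr_gt0 => //; lra.
Qed.

(* Main.v *)
(* Fourier inversion modulo m writes S_m(x) as the mean over t < m of the sums
   of (-1)^s(n) cos(2 pi n t / m).  Cutting x at its binary digits reduces these
   to sums over n < 2^k, which factor as products of 2 sin(2^h pi t / m).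

   Let u = |sin(pi n / m)| and u' = |sin(2 pi n / m)| be consecutive factors.
   Since 3 does not divide m, the angle stays away from pi/3, and either u <= b
   (u well below sqrt 3 / 2) or u u' <= u (sqrt 3 - u) <= b^2 (u well above), so
   that grouping factors greedily bounds the product of k sines by b^(k-1).
   Summing the geometric series in 2b gives the bound 2 (2b)^k / (2b - 1) when
   2^k <= x < 2^(k+1), and (2b)^k = (2^k)^lambda. *)
Require Import Defs.
From mathcomp Require Import all_boot all_order all_algebra.
From mathcomp Require Import all_classical all_reals all_analysis.
From mathcomp Require Import ring lra zify.

Import Order.TTheory GRing.Theory Num.Theory.

Local Open Scope ring_scope.

(** * Sine inequalities around pi/3 *)

Section Trigonometry.
Import numFieldNormedType.Exports.
Variable R : realType.
Implicit Types a x y : R.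

Lemma cos_pi3 : cos (pi / 3) = 1 / 2 :> R.
Proof.
have pi0 := pi_gt0 R.
have c0 : 0 < cos (pi / 3) :> R by apply: cos_gt0_pihalf; apply/andP; split; lra.
have E : pi = pi / 3 + (pi / 3 + pi / 3) :> R by field.
have := cospi R; rewrite {1}E !(cosD, sinD).
have := cos2Dsin2 (pi / 3 : R); set c := cos _ in c0 *; set s := sin _ => cs K.
(* The triple-angle formula at pi/3 reads 4 c^3 - 3 c = -1, which factors this way; c > 0 excludes c
   = -1. *)
have : (c + 1) * (2 * c - 1) ^+ 2 = 0.
  have S2 : s ^+ 2 = 1 - c ^+ 2 by lra.
  have -> : (c + 1) * (2 * c - 1) ^+ 2 = c ^+ 3 - 3 * (1 - c ^+ 2) * c - (-1) by ring.
  by rewrite -S2 -K; ring.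
by move/eqP; rewrite mulf_eq0 sqrf_eq0 => /orP[] /eqP; lra.
Qed.

Lemma sin_pi3 : sin (pi / 3) = Num.sqrt 3 / 2 :> R.
Proof.
have pi0 := pi_gt0 R.
have s0 : 0 < sin (pi / 3) :> R by apply: sin_gt0_pi; apply/andP; split; lra.
have s2 := sin2cos2 (pi / 3 : R); rewrite cos_pi3 in s2.
have E : 3 = (2 * sin (pi / 3)) ^+ 2 :> R by rewrite exprMn s2; field.
by have := congr1 Num.sqrt E; rewrite sqrtr_sqr ger0_norm; lra.
Qed.

Lemma cos_pi6 : cos (pi / 6) = Num.sqrt 3 / 2 :> R.
Proof.
have -> : pi / 6 = - (pi / 3 - pi / 2) :> R by field.
by rewrite cosN cosBpihalf sin_pi3.
Qed.

Lemma sin_pi6 : sin (pi / 6) = 1 / 2 :> R.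
Proof.
have -> : pi / 6 = pi / 2 - pi / 3 :> R by field.
by rewrite sinB sin_pihalf cos_pihalf cos_pi3 mul0r subr0 mul1r.
Qed.

Lemma ler_sin x y : - (pi / 2) <= x -> x <= y -> y <= pi / 2 -> sin x <= sin y.
Proof.
move=> hx xy hy; rewrite leNgt ltr_sin -?leNgt // in_itv /=; apply/andP; split; lra.
Qed.

Lemma sin_le_id x : 0 <= x -> sin x <= x.
Proof.
move=> x0; have sin_cont : {within `[0, x], continuous (@sin R)}%classic.
  by apply: continuous_subspaceT; exact: continuous_sin.
have [z _] := MVT_segment x0 (fun z _ => is_derive_sin z) sin_cont.
by rewrite sin0 !subr0 => ->; rewrite ler_piMl // cos_le1.
Qed.

Lemma sinDB x y : sin (x + y) + sin (x - y) = 2 * sin x * cos y.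
Proof. by rewrite sinB sinD; ring. Qed.

(** The sum is 2 sin(3a/2) cos(a/2), and a/2 >= pi/6. For u = sin a it yields u sin(2a) <= u (sqrt 3
    - u). *)
Lemma sin_add_sin_double a :
  pi / 3 <= a <= pi / 2 -> sin a + sin (2 * a) <= Num.sqrt 3.
Proof.
move=> /andP[a1 a2]; have pi0 := pi_gt0 R.
have -> : 2 * a = 3 * a / 2 + a / 2 by field.
have -> : sin a = sin (3 * a / 2 - a / 2) by congr sin; field.
rewrite addrC sinDB.
have c0 : 0 <= cos (a / 2) by apply: cos_ge0_pihalf; apply/andP; split; lra.
have c1 : cos (a / 2) <= Num.sqrt 3 / 2.
  rewrite -cos_pi6 leNgt ltr_cos ?in_itv /= -?leNgt; first lra.
  1,2: by apply/andP; split; lra.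
by have := sin_le1 (3 * a / 2); nra.
Qed.

(** Used for m = 2 mod 3 with x = pi/(3m): the multiples of pi/m nearest to pi/3 are then pi/3 + x
    and pi/3 - 2x. *)
Lemma sin_pi3D_sin_pi3B_le x : 0 <= x <= pi / 15 ->
  sin (pi / 3 + x) + sin (pi / 3 - 2 * x) <= Num.sqrt 3.
Proof.
move=> /andP[x0 x1]; have pi0 := pi_gt0 R.
have -> : pi / 3 + x = (pi / 3 - x / 2) + 3 * x / 2 by field.
have -> : pi / 3 - 2 * x = (pi / 3 - x / 2) - 3 * x / 2 by field.
rewrite sinDB.
have s0 : 0 <= sin (pi / 3 - x / 2) by apply: sin_ge0_pi; apply/andP; split; lra.
have : sin (pi / 3 - x / 2) <= sin (pi / 3) by apply: ler_sin; lra.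
by rewrite sin_pi3; have := cos_le1 (3 * x / 2); nra.
Qed.

(** Used for m = 1 mod 3, where the nearest multiples are pi/3 - x and pi/3 + 2x. With s = sin(x/2),
    the sum exceeds sqrt 3 to first order in s, and s <= 1/10 controls the quadratic loss. *)
Lemma sin_pi3D_sin_pi3B_ge x : 0 <= x <= pi / 21 ->
  Num.sqrt 3 <= sin (pi / 3 + 2 * x) + sin (pi / 3 - x).
Proof.
move=> /andP[x0 x1]; have pi0 := pi_gt0 R; have pi4 := pihalf_lt2 R.
have -> : pi / 3 + 2 * x = (pi / 3 + x / 2) + 3 * x / 2 by field.
have -> : pi / 3 - x = (pi / 3 + x / 2) - 3 * x / 2 by field.
rewrite sinDB sinD sin_pi3 cos_pi3.
have -> : 3 * x / 2 = x / 2 + (x / 2 + x / 2) by field.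
have s0 : 0 <= sin (x / 2) by apply: sin_ge0_pi; apply/andP; split; lra.
have s1 : sin (x / 2) <= 1 / 10 by apply: le_trans (sin_le_id _ _) _; lra.
have c0 : 0 <= cos (x / 2) by apply: cos_ge0_pihalf; apply/andP; split; lra.
rewrite !(cosD, sinD); have := cos2Dsin2 (x / 2).
move: (cos _) (sin _) c0 s0 s1 => c s c0 s0 s1 cs.
have q0 := sqrtr_ge0 (3 : R); have := sqr_sqrtr (ler0n R 3).
move: (Num.sqrt 3) q0 => q q0 q2.
have q1 : q <= 7 / 4 by nra.
have c1 : 99 / 100 <= c by nra.
have c2 : c ^+ 2 = 1 - s ^+ 2 by lra.
have -> : c * (c * c - s * s) - s * (s * c + c * s) =
    c * (c ^+ 2 - 3 * s ^+ 2) by ring.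
have -> : c ^+ 2 - 3 * s ^+ 2 = 1 - 4 * s ^+ 2 by lra.
have -> : 2 * (q / 2 * c + 1 / 2 * s) * (c * (1 - 4 * s ^+ 2)) =
   (q * (1 - s ^+ 2) + s * c) * (1 - 4 * s ^+ 2) by rewrite -c2; field.
have h1 : 5 * q * s <= c * (1 - 4 * s ^+ 2) by nra.
have -> : (q * (1 - s ^+ 2) + s * c) * (1 - 4 * s ^+ 2) =
   q + s * (c * (1 - 4 * s ^+ 2) - 5 * q * s) + 4 * q * s ^+ 4 by ring.
rewrite -addrA lerDl addr_ge0 ?mulr_ge0 ?subr_ge0 ?exprn_ge0 //.
Qed.

End Trigonometry.

(** * The gap at multiples of pi/m *)

Section SineGap.
Variables (R : realType) (m : nat).
Hypotheses (m_ge5 : (5 <= m)%N) (m_coprime3 : gcdn m 3 = 1%N).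
Local Notation b := (b R m).

Let b_gt0 : 0 < b. Proof. by case: (b_spec R m_ge5). Qed.
Let b_sqrE : b ^+ 2 = b_sqr R m. Proof. by case: (b_spec R m_ge5). Qed.

Let inv_m_gt0 : 0 < (m%:R : R)^-1. Proof. by rewrite invr_gt0 ltr0n; lia. Qed.
Let inv_m_mul : m%:R * (m%:R : R)^-1 = 1.
Proof. by rewrite divff // pnatr_eq0; lia. Qed.

Let inv_m_le k : (0 < k <= m)%N -> (m%:R : R)^-1 <= k%:R^-1.
Proof.
by move=> /andP[k0 km]; rewrite lef_pV2 ?ler_nat // posrE ltr0n // (leq_trans k0).
Qed.

Lemma sin_arg_mod3 :
  (m %% 3 = 1)%N /\ sin_arg R m = pi / 3 - pi * m%:R^-1 / 3 \/
  (m %% 3 = 2)%N /\ sin_arg R m = pi / 3 + pi * m%:R^-1 / 3.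
Proof.
have : (m %% 3 != 0)%N.
  by apply/negP => /gcdn_idPr; rewrite m_coprime3.
have := ltn_pmod m (isT : (0 < 3)%N); rewrite /sin_arg.
by case: (m %% 3)%N => [|[|[|]]] //= _ _; [left | right]; split => //; ring.
Qed.

(** Completing the square gives b^2 <= 3/4. *)
Lemma b_le1 : b <= 1.
Proof.
have E := b_sqrE; have := b_gt0; rewrite /b_sqr in E.
have := sqr_sqrtr (ler0n R 3) => q2.
have : 0 <= (sin (sin_arg R m) - Num.sqrt 3 / 2) ^+ 2 by exact: sqr_ge0.
nra.
Qed.

(** [sin_arg] stays above pi/6, and the concave polynomial s (sqrt 3 - s) exceeds 1/4 on [1/2, 1].
    Hence the ratio 2b of the geometric series exceeds 1. *)
Lemma b_gt_half : 1 / 2 < b.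
Proof.
have pi0 := pi_gt0 R.
have i0 := inv_m_gt0; have i5 : (m%:R : R)^-1 <= 5^-1 := inv_m_le 5 m_ge5.
have half : 1 / 2 <= sin (sin_arg R m).
  by rewrite -sin_pi6; case: sin_arg_mod3 => -[_ ->]; apply: ler_sin; nra.
have q2 := sqr_sqrtr (ler0n R 3); have q0 := sqrtr_ge0 (3 : R).
have q1 : 17 / 10 <= Num.sqrt 3 :> R by nra.
have E := b_sqrE; have := b_gt0; rewrite /b_sqr in E.
have := sin_le1 (sin_arg R m); nra.
Qed.

Lemma sin_first_quadrant (r : nat) : (2 * r <= m)%N ->
  let a : R := pi * (r%:R / m%:R) in
  sin a <= b \/ sin a * sin (2 * a) <= b ^+ 2.
Proof.
move=> rm a; have pi0 := pi_gt0 R.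
have ge_pi (p : nat) (x : R) : (p%:R : R) <= x ->
      pi * (p%:R / m%:R) <= pi * (x / m%:R).
  by move=> px; rewrite ler_wpM2l ?pi_ge0 // ler_wpM2r // ltW.
have le_pi (p : nat) (x : R) : x <= (p%:R : R) ->
      pi * (x / m%:R) <= pi * (p%:R / m%:R).
  by move=> px; rewrite ler_wpM2l ?pi_ge0 // ler_wpM2r // ltW.
have piE : pi * (m%:R / m%:R) = pi :> R by rewrite inv_m_mul mulr1.
have a0 : 0 <= a by rewrite /a mulr_ge0 ?pi_ge0 // mulr_ge0 // ltW.
have a2 : a <= pi / 2.
  have : (r%:R : R) <= m%:R / 2.
    by have : ((2 * r)%:R <= m%:R :> R); [rewrite ler_nat | rewrite natrM; lra].
  by move/ge_pi; rewrite -/a; lra.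
have ai : pi * m%:R^-1 <= pi / 5 :> R.
  by rewrite ler_pM2l //; exact: (inv_m_le 5).
have ai0 : 0 < pi * m%:R^-1 :> R by rewrite mulr_gt0.
have ab := sin_add_sin_double R a.
have sa0 : 0 <= sin a by apply: sin_ge0_pi; apply/andP; split; lra.
have E := b_sqrE; have b0 := b_gt0; rewrite /b_sqr in E.
have q2 := sqr_sqrtr (ler0n R 3); have q0 := sqrtr_ge0 (3 : R).
case: sin_arg_mod3 => -[m3 argE]; rewrite argE in E.
(* Here m >= 7. Put v = sin(pi/3 - pi/(3m)) <= sqrt 3 / 2. Below the gap, u = sin a <= v and v^2 <=
   v (sqrt 3 - v) = b^2. Above it, u >= sqrt 3 - v >= sqrt 3 / 2, where u (sqrt 3 - u) decreases in
   u, so it is at most b^2. *)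
- have lo : (3 * r + 1 <= m)%N \/ (m + 2 <= 3 * r)%N by lia.
  have ai7 : pi * m%:R^-1 <= pi / 7 :> R.
    by rewrite ler_pM2l //; apply: (inv_m_le 7); lia.
  have A : Num.sqrt 3 <= sin (pi / 3 + 2 * (pi * m%:R^-1 / 3)) +
      sin (pi / 3 - pi * m%:R^-1 / 3) :> R.
    by apply: sin_pi3D_sin_pi3B_ge; apply/andP; split; lra.
  have u0 : sin (pi / 3 - pi * m%:R^-1 / 3) <= Num.sqrt 3 / 2 :> R.
    by rewrite -sin_pi3; apply: ler_sin; lra.
  case: lo => lo.
  + left; have : (r%:R : R) <= (m%:R - 1) / 3.
      by have : ((3 * r + 1)%:R <= m%:R :> R);
        [rewrite ler_nat | rewrite natrD natrM; lra].
    move/ge_pi; rewrite -/a => aup.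
    have : sin a <= sin (pi / 3 - pi * m%:R^-1 / 3) by apply: ler_sin; lra.
    nra.
  + right; have : (m%:R + 2) / 3 <= (r%:R : R).
      by have : ((m + 2)%:R <= (3 * r)%:R :> R);
        [rewrite ler_nat | rewrite natrD natrM; lra].
    move/le_pi; rewrite -/a => alo.
    have : sin (pi / 3 + 2 * (pi * m%:R^-1 / 3)) <= sin a by apply: ler_sin; lra.
    have /ab : pi / 3 <= a <= pi / 2 by apply/andP; split; lra.
    rewrite E; nra.
(* Now v = sin(pi/3 + pi/(3m)) >= sqrt 3 / 2 and the roles swap: below the gap u <= sqrt 3 - v <= v,
   above it u >= v. *)
- have lo : (3 * r + 2 <= m)%N \/ (m + 1 <= 3 * r)%N by lia.
  have A : sin (pi / 3 + pi * m%:R^-1 / 3) +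
      sin (pi / 3 - 2 * (pi * m%:R^-1 / 3)) <= Num.sqrt 3 :> R.
    by apply: sin_pi3D_sin_pi3B_le; apply/andP; split; lra.
  have u0 : Num.sqrt 3 / 2 <= sin (pi / 3 + pi * m%:R^-1 / 3) :> R.
    by rewrite -sin_pi3; apply: ler_sin; lra.
  case: lo => lo.
  + left; have : (r%:R : R) <= (m%:R - 2) / 3.
      by have : ((3 * r + 2)%:R <= m%:R :> R);
        [rewrite ler_nat | rewrite natrD natrM; lra].
    move/ge_pi; rewrite -/a => aup.
    have : sin a <= sin (pi / 3 - 2 * (pi * m%:R^-1 / 3)) by apply: ler_sin; lra.
    nra.
  + right; have : (m%:R + 1) / 3 <= (r%:R : R).
      by have : ((m + 1)%:R <= (3 * r)%:R :> R);
        [rewrite ler_nat | rewrite natrD natrM; lra].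
    move/le_pi; rewrite -/a => alo.
    have : sin (pi / 3 + pi * m%:R^-1 / 3) <= sin a by apply: ler_sin; lra.
    have /ab : pi / 3 <= a <= pi / 2 by apply/andP; split; lra.
    rewrite E; nra.
Qed.

(** Adding m to n shifts a by pi, and replacing the residue r by m - r turns a into pi - a; both
    preserve |sin a| and |sin(2a)|, so the first quadrant suffices. *)
Lemma norm_sin_gap (n : nat) :
  let a : R := pi * (n%:R / m%:R) in
  `|sin a| <= b \/ `|sin a| * `|sin (2 * a)| <= b ^+ 2.
Proof.
have quadrant r : (2 * r <= m)%N -> let a : R := pi * (r%:R / m%:R) in
    `|sin a| <= b \/ `|sin a| * `|sin (2 * a)| <= b ^+ 2.
  move=> rm a; have pi0 := pi_gt0 R.
  have a0 : 0 <= a by rewrite /a mulr_ge0 ?pi_ge0 // mulr_ge0 // ltW.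
  have a2 : 2 * a <= pi.
    have : ((2 * r)%:R / m%:R <= 1 :> R).
      by rewrite ler_pdivrMr ?mul1r ?ler_nat // ltr0n; lia.
    by rewrite natrM /a; nra.
  rewrite !ger0_norm; first exact: sin_first_quadrant.
  1,2: by apply: sin_ge0_pi; apply/andP; split; lra.
rewrite {1}(divn_eq n m); elim: (n %/ m)%N => [|q IH] /=.
  rewrite mul0n add0n.
  have [|lt] := leqP (2 * (n %% m)) m; first exact: quadrant.
  have rm : (n %% m < m)%N by rewrite ltn_mod; lia.
  have rm' : (2 * (m - n %% m) <= m)%N by lia.
  have := quadrant _ rm' => /=.
  rewrite (natrB R (ltnW rm)) mulrBl inv_m_mul mulrBr mulr1.
  set a := pi * _; have -> : sin (pi - a) = sin a.
    by rewrite sinB sinpi cospi; ring.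
  have -> : 2 * (pi - a) = - (2 * a) + pi *+ 2 by rewrite mulr2n; ring.
  by rewrite sinD2pi sinN normrN.
have -> : ((q.+1 * m + n %% m)%:R / m%:R : R) = (q * m + n %% m)%:R / m%:R + 1.
  by rewrite mulSn -addnA natrD mulrDl inv_m_mul addrC.
rewrite mulrDr mulr1 sinDpi normrN.
by rewrite mulrDr [2 * pi]mulr_natl sinD2pi.
Qed.

End SineGap.

(** * Greedy grouping of a product *)

Lemma prod_le_of_gap (R : realDomainType) (c : R) (l : nat -> R) (k : nat) :
    0 <= c <= 1 -> (forall h, 0 <= l h <= 1) ->
    (forall h, l h <= c \/ l h * l h.+1 <= c ^+ 2) ->
  c * \prod_(h < k) l h <= c ^+ k.
Proof.
move=> /andP[c0 c1]; have [p] := ubnP k; elim: p k l => // p IH k l kp l01 gap.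
have prod0 (l' : nat -> R) j : (forall h, 0 <= l' h <= 1) -> 0 <= c * \prod_(h < j) l' h.
  by move=> l'01; rewrite mulr_ge0 // prodr_ge0 // => h _; case/andP: (l'01 h).
have prod_shift (l' : nat -> R) j :
    \prod_(h < j.+1) l' h = l' 0%N * \prod_(h < j) (l' \o S) h.
  by rewrite big_ord_recl.
case: k kp => [|k] kp; first by rewrite big_ord0 mulr1 expr0.
have /andP[l0 l1] := l01 0%N.
case: (gap 0%N) => [lc|llc].
  rewrite prod_shift mulrCA exprS ler_pM ?prod0 // => [h|]; first exact: l01.
  by apply: IH => [|h|h] //; [exact: l01 | exact: gap].
(* A last factor left without a partner is only bounded by 1; the extra c on the left pays for
   it. *)
case: k kp => [|k] kp; first by rewrite big_ord1 expr1 ler_piMr.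
have /andP[l0' _] := l01 1%N.
rewrite 2!prod_shift mulrCA [c * _]mulrCA mulrA (exprD c 2 k).
rewrite ler_pM ?prod0 ?mulr_ge0 // => [h|]; first exact: l01.
by apply: IH => [|h|h] //; [exact: ltnW | exact: l01 | exact: gap].
Qed.

(** * Binary digit sums *)

Lemma binary_ones_widen (k n : nat) : (n < 2 ^ k)%N ->
  binary_ones n = (\sum_(i < k) odd (n %/ 2 ^ i))%N.
Proof.
have widen j p : (n < 2 ^ j)%N ->
    (\sum_(i < j + p) odd (n %/ 2 ^ i) = \sum_(i < j) odd (n %/ 2 ^ i))%N.
  move=> nj; rewrite big_split_ord /= [X in (_ + X)%N]big1 ?addn0 // => i _.
  by rewrite divn_small // (leq_trans nj) // leq_exp2l // leq_addr.
(* The cut-offs k and n are both compared with k + n. *)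
move=> nk; rewrite -[RHS](widen k n nk) addnC.
by rewrite (widen n k (ltn_expl n (isT : (1 < 2)%N))).
Qed.

Lemma binary_ones_pow2D (k n : nat) : (n < 2 ^ k)%N ->
  binary_ones (2 ^ k + n) = (binary_ones n).+1.
Proof.
move=> nk; rewrite (binary_ones_widen k.+1) ?expnS ?mul2n -?addnn ?ltn_add2l //.
rewrite (binary_ones_widen k) // big_ord_recr /= -[RHS]addn1; congr (_ + _)%N.
  (* For i < k the added 2^k changes the quotient by 2^(k - i), which is even. *)
  apply: eq_bigr => i _; rewrite -[in (2 ^ k)%N](subnK (ltnW (ltn_ord i))) expnD.
  by rewrite divnMDl ?expn_gt0 // oddD oddX subn_eq0 leqNgt ltn_ord.
by rewrite -{1}[(2 ^ k)%N]mul1n divnMDl ?expn_gt0 // divn_small.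
Qed.

(** * Trigonometric sums twisted by the digit sign, and Fourier inversion *)

Section GelfondSum.
Variable R : realType.
Implicit Types (al phi : R) (k x y : nat).

(* Real part of e^(i phi) * sum_(n < x) (-1)^s(n) e^(i n al): the free phase
   phi replaces complex exponentials. *)
Definition gelfond_sum al phi x : R :=
  \sum_(n < x) (-1) ^+ binary_ones n * cos (n%:R * al + phi).

Lemma gelfond_sum_pow2D al phi k y : (y <= 2 ^ k)%N ->
  gelfond_sum al phi (2 ^ k + y) =
  gelfond_sum al phi (2 ^ k) - gelfond_sum al ((2 ^ k)%:R * al + phi) y.
Proof.
move=> yk; rewrite /gelfond_sum big_split_ord /= -sumrN; congr (_ + _).
apply: eq_bigr => n _; rewrite binary_ones_pow2D ?(leq_trans (ltn_ord n)) //.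
by rewrite exprS mulN1r mulNr natrD; congr (- (_ * cos _)); ring.
Qed.

(** The real form of the product of the factors 1 - e^(i 2^h al), psi collecting their arguments. It
    must not depend on phi, since the induction uses it at two phases. *)
Lemma gelfond_sum_pow2 al k : exists psi, forall phi,
  gelfond_sum al phi (2 ^ k) =
  (\prod_(h < k) (2 * sin ((2 ^ h)%:R * (al / 2)))) * cos (phi + psi).
Proof.
elim: k => [|k [psi IH]].
  exists 0 => phi; rewrite /gelfond_sum big_ord0 big_ord1 /binary_ones big_ord0.
  by rewrite expr0 !mul1r mul0r add0r addr0.
(* From cos(z - d) - cos(z + d) = 2 sin d cos(z - pi/2) with d = 2^k al / 2. *)
exists (psi + (2 ^ k)%:R * (al / 2) - pi / 2) => phi.
rewrite expnS mul2n -addnn gelfond_sum_pow2D // !IH big_ord_recr /= -mulrBr -mulrA.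
congr (_ * _); set d := (2 ^ k)%:R * (al / 2).
have -> : phi + psi = (phi + psi + d) - d by ring.
have -> : (2 ^ k)%:R * al + phi + psi = (phi + psi + d) + d by rewrite /d; field.
have -> : phi + (psi + d - pi / 2) = (phi + psi + d) - pi / 2 by ring.
by rewrite cosBpihalf; move: (phi + psi + d) => z; rewrite cosB cosD; ring.
Qed.

Lemma norm_gelfond_sum_pow2_le al phi k :
  `|gelfond_sum al phi (2 ^ k)| <= 2 ^+ k * \prod_(h < k) `|sin ((2 ^ h)%:R * (al / 2))|.
Proof.
have [psi ->] := gelfond_sum_pow2 al k.
rewrite normrM normr_prod.
under eq_bigr do rewrite normrM ger0_norm //.
rewrite big_split /= prodr_const card_ord ler_piMr ?cos_max //.
by rewrite mulr_ge0 ?exprn_ge0 // prodr_ge0.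
Qed.

(** The bound is the geometric sum of (2c)^j / c over j < k, cleared of denominators. Removing the
    top binary digit of x changes the phase, so the induction is uniform in phi. *)
Lemma norm_gelfond_sum_le al (c : R) : 1 / 2 < c <= 1 ->
    (forall h, let a := (2 ^ h)%:R * (al / 2) in
      `|sin a| <= c \/ `|sin a| * `|sin (2 * a)| <= c ^+ 2) ->
  forall k phi x, (x < 2 ^ k)%N ->
    c * (2 * c - 1) * `|gelfond_sum al phi x| <= (2 * c) ^+ k - 1.
Proof.
move=> /andP[c2 c1] gap.
have pow2 phi k : c * `|gelfond_sum al phi (2 ^ k)| <= (2 * c) ^+ k.
  apply: le_trans (ler_wpM2l _ (norm_gelfond_sum_pow2_le _ _ _)) _; first lra.
  rewrite mulrCA exprMn ler_wpM2l ?exprn_ge0 //.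
  apply: (@prod_le_of_gap _ c (fun h => `|sin ((2 ^ h)%:R * (al / 2))|)) => [|h|h].
    by apply/andP; split; lra.
    by rewrite normr_ge0 sin_max.
  by rewrite expnS natrM -mulrA; exact: gap.
elim=> [|k IH] phi x xk.
  move: xk; rewrite ltnS leqn0 => /eqP ->.
  by rewrite /gelfond_sum big_ord0 normr0 mulr0 subrr.
have c0 : 0 < c by lra.
have B1 : 1 <= (2 * c) ^+ k by rewrite exprn_ege1 //; lra.
have [xk'|kx] := ltnP x (2 ^ k).
  by apply: le_trans (IH phi _ xk') _; rewrite exprS; nra.
have yk : (x - 2 ^ k < 2 ^ k)%N by move: xk; rewrite expnS; lia.
rewrite -(subnKC kx) gelfond_sum_pow2D 1?ltnW //.
have := IH ((2 ^ k)%:R * al + phi) _ yk; have := pow2 phi k.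
set u := gelfond_sum _ _ _; set v := gelfond_sum _ _ _ => hu hv.
have w : 0 <= c * (2 * c - 1) by apply: mulr_ge0; lra.
apply: le_trans (ler_wpM2l w (ler_normB u v)) _.
have : (2 * c - 1) * (c * `|u|) <= (2 * c - 1) * (2 * c) ^+ k by apply: ler_wpM2l; lra.
by rewrite exprS; lra.
Qed.

(** Telescoping of 2 sin(x/2) cos(t x) = sin(t x + x/2) - sin(t x - x/2). *)
Lemma sum_cos_multiples (x : R) (m : nat) :
  2 * sin (x / 2) * \sum_(t < m) cos (t%:R * x) =
  sin (m%:R * x - x / 2) + sin (x / 2).
Proof.
elim: m => [|m IH]; first by rewrite big_ord0 mulr0 mul0r sub0r sinN addNr.
rewrite big_ord_recr mulrDr IH /= -[m.+1]addn1 natrD.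
have -> : (m%:R + 1) * x - x / 2 = m%:R * x + x / 2 by field.
by rewrite sinB sinD; ring.
Qed.

Lemma sum_cos_roots_of_unity (m n : nat) : (0 < m)%N ->
  \sum_(t < m) cos (n%:R * (2 * (pi * (t%:R / m%:R)))) =
  (if (m %| n)%N then m%:R else 0 : R).
Proof.
move=> m0; have mR : (m%:R : R) != 0 by rewrite pnatr_eq0 -lt0n.
case: ifPn => [/dvdnP[q ->]|ndvd].
  rewrite -[in RHS](card_ord m) -sumr_const; apply: eq_bigr => t _.
  have -> : (q * m)%:R * (2 * (pi * (t%:R / m%:R))) = 0 + pi *+ 2 *+ (q * t) :> R.
    by rewrite -mulrnA -[pi *+ _]mulr_natr !natrM; field.
  by rewrite (periodicn (@cosD2pi R)) cos0.
(* Now x/2 is not a multiple of pi, so sin(x/2) can be cancelled, while m x is a multiple of 2 pi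
   and the telescoped sum vanishes. *)
pose x : R := 2 * (pi * (n%:R / m%:R)).
rewrite (eq_bigr (fun t : 'I_m => cos (t%:R * x))); last first.
  by move=> t _; congr cos; rewrite /x; field.
have sx : sin (x / 2) != 0.
  have -> : x / 2 = pi * ((n %% m)%:R / m%:R) + pi *+ (n %/ m).
    rewrite /x {1}(divn_eq n m) natrD natrM -[pi *+ _]mulr_natr; field.
    by [].
  rewrite (alternatingn (@sinDpi R)) mulf_neq0 ?signr_eq0 // ?gt_eqF //.
  apply: sin_gt0_pi; rewrite mulr_gt0 ?pi_gt0 ?divr_gt0 ?ltr0n // ?lt0n //=.
  by rewrite gtr_pMr ?pi_gt0 // ltr_pdivrMr ?ltr0n // mul1r ltr_nat ltn_mod.
have sx2 : 2 * sin (x / 2) != 0 by apply: mulf_neq0 sx; rewrite gt_eqF.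
apply: (mulfI sx2); rewrite mulr0 sum_cos_multiples.
have -> : m%:R * x - x / 2 = - (x / 2) + pi *+ 2 *+ n.
  by rewrite -mulrnA -[pi *+ _]mulr_natr natrM /x; field.
by rewrite (periodicn (@sinD2pi R)) sinN addNr.
Qed.

Lemma S_gelfond_sum (m x : nat) : (0 < m)%N ->
  m%:R * (S_ m x)%:~R = \sum_(t < m) gelfond_sum (2 * (pi * (t%:R / m%:R))) 0 x.
Proof.
move=> m0; rewrite /gelfond_sum exchange_big /= /S_ big_mkord.
rewrite rmorph_sum /= mulr_sumr big_mkcond /=; apply: eq_bigr => n _.
under [RHS]eq_bigr do rewrite addr0.
rewrite -mulr_sumr sum_cos_roots_of_unity //.
by case: ifP => _; rewrite ?mulr0 // rmorphXn /= rmorphN1 mulrC.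
Qed.

End GelfondSum.

(** * The growth exponent and the final bound *)

Lemma pow2_le_powR_lambda (R : realType) (m : nat) : 1 / 2 < b R m ->
  forall k x : nat, (2 ^ k <= x)%N -> (2 * b R m) ^+ k <= x%:R `^ lambda R m.
Proof.
move=> b2 k x kx; have ln2 : 0 < ln 2 :> R by rewrite ln_gt0 // ltr1n.
(* Equivalently 2^lambda = 2b; as 2b > 1, lambda is nonnegative and x^lambda is monotone in x. *)
have lambdaE : lambda R m * ln 2 = ln (2 * b R m).
  by rewrite lnM ?posrE; [rewrite /lambda; field; rewrite gt_eqF | lra..].
have lambda_ge0 : 0 <= lambda R m.
  by rewrite -(pmulr_lge0 _ ln2) lambdaE ln_ge0 //; lra.
have <- : (2 ^ k)%:R `^ lambda R m = (2 * b R m) ^+ k.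
  rewrite natrX -powR_mulrn // -powRrM mulrC powRrM powR_mulrn ?powR_ge0 //.
  by congr (_ ^+ k); rewrite /powR pnatr_eq0 lambdaE lnK // posrE; lra.
by apply: ge0_ler_powR => //; rewrite ?nnegrE ?ler0n // ler_nat.
Qed.

Theorem theorem1 (R : realType) (m : nat) (hm : (5 <= m)%N)
    (hm3 : gcdn m 3 = 1%N) (x : nat) (hx : (0 < x)%N) :
  `|(S_ m x)%:~R| <= mu R m * x%:R `^ lambda R m.
Proof.
have m0 : (0 < m)%N by lia.
have b2 : 1 / 2 < b R m by exact: b_gt_half.
have b1 : b R m <= 1 by exact: b_le1.
have B1 : 0 < 2 * b R m - 1 by lra.
have mu_ge0 : 0 <= mu R m by rewrite /mu divr_ge0 ?ltW //; lra.
have /andP[kx xk] := trunc_log_bounds (isT : (1 < 2)%N) hx.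
set k := trunc_log 2 x in kx xk.
have xlambda := pow2_le_powR_lambda _ _ b2 _ _ kx.
have bound (t : 'I_m) : `|gelfond_sum R (2 * (pi * (t%:R / m%:R))) 0 x| <=
    mu R m * x%:R `^ lambda R m.
  have gap h : let a := (2 ^ h)%:R * (2 * (pi * (t%:R / m%:R)) / 2) in
      `|sin a| <= b R m \/ `|sin a| * `|sin (2 * a)| <= b R m ^+ 2.
    have -> : (2 ^ h)%:R * (2 * (pi * (t%:R / m%:R)) / 2) =
        pi * ((2 ^ h * t)%:R / m%:R) :> R.
      by rewrite natrM; field; rewrite pnatr_eq0 -lt0n.
    exact: norm_sin_gap.
  have b12 : 1 / 2 < b R m <= 1 by rewrite b2.
  have := norm_gelfond_sum_le R _ _ b12 gap k.+1 0 x xk.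
  rewrite exprS => le_g; apply: le_trans (ler_wpM2l _ xlambda) => //.
  set B := (2 * b R m) ^+ k in le_g *.
  have B0 : 0 <= B by rewrite exprn_ge0 // mulr_ge0 // ltW // (lt_trans _ b2) // divr_gt0.
  rewrite /mu mulrAC ler_pdivlMr //.
  have b0 : 0 < b R m by rewrite (lt_trans _ b2) // divr_gt0.
  rewrite -(ler_pM2l b0).
  (* This is the slack between b (2b + 1) B, wanted for [mu], and the 2b B obtained from the
     geometric series. *)
  have : 0 <= b R m * B * (2 * b R m - 1) by rewrite !mulr_ge0 // ltW.
  by move: (`|_|) B B0 le_g => g B _; clear; lra.
(* All m frequencies satisfy the same bound, hence so does their mean. *)
rewrite -(ler_pM2l (_ : 0 < m%:R)) ?ltr0n //.
rewrite -[X in X * `|_|]ger0_norm // -normrM S_gelfond_sum //.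
apply: le_trans (ler_norm_sum _ _ _) _.
apply: le_trans (ler_sum _ (fun t _ => bound t)) _.
by rewrite sumr_const card_ord mulr_natl.
Qed.
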